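(* Let $\mathcal{G}=(V,E)$ be a finite connected simple graph, with $n(V)$ nodes and $n(E)$ edges. Then the number of valid routes in $\mathcal{F}_1$ is at least $2^{\,1-n(V)+n(E)}$.
   Context: A route is a closed walk in $\mathcal{G}$, written as a vector of nodes $R=(R[0],\dots,R[M])$ with $R[0]=R[M]$ and consecutive nodes adjacent, which traverses every edge of $E$ at least once and at most twice (in any directions). $\mathcal{F}_1$ is the set of all routes; two routes are distinct if they differ as sequences of (directed) edge visits. *)

(* Defs.v *)
From mathcomp Require Import all_boot.
Set Implicit Arguments.
Unset Strict Implicit.
Unset Printing Implicit Defensive.

(* A simple graph on V is a symmetric irreflexive adjacency relation e. *)
Section Routes.

Variables (V : finType) (e : rel V).

Definition edges : {set {set V}} := [set [set x; y] | x in V, y in e x].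

(* The graph with no node is not connected. *)
Definition connected_graph : Prop :=
  (0 < #|V|) /\ (forall x y : V, connect e x y).

(* R = [:: R[0]; ...; R[M]], with M = 0 allowed. *)
Definition closed_walk (R : seq V) : bool :=
  if R is x :: p then path e x p && (last x p == x) else false.

(* The directed edge visits (R[0], R[1]), ..., (R[M-1], R[M]). *)
Definition edge_visits (R : seq V) : seq (V * V) := zip R (behead R).

(* The number of traversals of the edge f, in either direction. *)
Definition traversals (f : {set V}) (R : seq V) : nat :=
  count (fun d : V * V => [set d.1; d.2] == f) (edge_visits R).

Definition route (R : seq V) : bool :=
  closed_walk R && [forall f in edges, 1 <= traversals f R <= 2].

Lemma route_size (R : seq V) : route R -> size R <= (2 * #|edges|).+1.
Proof.
case: R => [|x p] // /andP[/andP[ep _] /forall_inP trR].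
have szR: size (edge_visits (x :: p)) = size p.
  by rewrite size_zip /= (minn_idPr _).
rewrite [size _]/= ltnS -szR.
have visE: all (fun d : V * V => [set d.1; d.2] \in edges)
               (edge_visits (x :: p)).
  elim: p x ep {szR trR} => //= y p IHp x /andP[exy /IHp ->].
  by rewrite andbT; apply/imset2P; exists x y; rewrite ?inE.
have -> : size (edge_visits (x :: p))
          = \sum_(f in edges) traversals f (x :: p).
  rewrite /traversals; elim: (edge_visits _) visE => [|d s IHs] /=.
    by rewrite big1.
  case/andP=> dE /IHs ->; rewrite big_split /= -add1n; congr (_ + _).
  rewrite (bigD1 _ dE) /= eqxx; by rewrite big1 ?addn0 // => f /andP[_ /negPf]; rewrite eq_sym => ->.
rewrite mulnC -sum_nat_const; apply: leq_sum => f /trR.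
by case/andP.
Qed.

(* The set of all routes; by route_size the length bound, which only serves
   to work in a finite type, excludes no route. *)
Definition F1 : {set {bseq (2 * #|edges|).+1 of V}} :=
  [set R : {bseq (2 * #|edges|).+1 of V} | route R].

Lemma mem_F1 (R : seq V) :
  route R <-> exists2 R' : {bseq (2 * #|edges|).+1 of V},
                R' \in F1 & R = R' :> seq V.
Proof.
split=> [rR | [R' + ->]]; last by rewrite inE.
by exists (Bseq (route_size rR)); rewrite ?inE.
Qed.

(* Routes are counted up to equality of their sequences of edge visits. *)
Definition num_routes : nat :=
  size (undup [seq edge_visits R | R : {bseq _ of V} in F1]).

End Routes.

(* Main.v *)
Require Import Defs.
From mathcomp Require Import all_boot all_order all_algebra.
Import GRing.Theory Num.Theory.
Local Open Scope ring_scope.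

Set Implicit Arguments.
Unset Strict Implicit.
Unset Printing Implicit Defensive.

(** Grow a connected set of edges one edge at a time from a single node, keeping
a family of closed walks that traverse each of these edges exactly twice. To
add an edge [{x, y}] with [x] already visited, insert the detour [x, y, x] at
the first visit of [x]; when [y] was visited too, the detour [y, x, y] at the
first visit of [y] is a second possibility. Deleting the visits of [{x, y}]
recovers the old walk and the direction of the first one recovers the choice,
so the family doubles for each edge that brings no new node, and there are
[1 - n(V) + n(E)] of these. *)

Section Detours.
Local Open Scope nat_scope.
Variables (V : finType) (e : rel V).
Hypothesis e_sym : symmetric e.
Implicit Types (x y z : V) (R p q : seq V) (f : {set V}).

Lemma edge_visits_cat p x q :
  edge_visits (p ++ x :: q) = edge_visits (rcons p x) ++ edge_visits (x :: q).
Proof.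
elim: p => [|a p IHp] //=; case: p IHp => [|b p] //= IHp.
by rewrite /edge_visits /= in IHp *; rewrite IHp.
Qed.

Lemma mem_edge_visits R (d : V * V) :
  d \in edge_visits R -> (d.1 \in R) && (d.2 \in R).
Proof.
elim: R => [|a [|b p] IHp] //; rewrite inE => /predU1P[->|/IHp/andP[d1 d2]].
  by rewrite !inE !eqxx orbT.
by rewrite 2!(in_cons a) d1 d2 !orbT.
Qed.

Definition detour x y R : seq V :=
  let i := index x R in take i R ++ [:: x, y, x & drop i.+1 R].

Lemma split_index x R :
  x \in R -> R = take (index x R) R ++ x :: drop (index x R).+1 R.
Proof.
by move=> Rx; rewrite -[LHS](cat_take_drop (index x R)) (drop_nth x) ?index_mem // nth_index.
Qed.

Lemma mem_detour x y R : x \in R -> detour x y R =i y :: R.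
Proof.
move=> Rx z; rewrite [in RHS](split_index Rx) /detour !(inE, mem_cat).
by case: (z == x); case: (z == y); rewrite ?orbT.
Qed.

Lemma detour_closed x y R :
  x \in R -> e x y -> closed_walk e R -> closed_walk e (detour x y R).
Proof.
move=> Rx exy; rewrite [in X in X -> _](split_index Rx) /detour.
case: (take _ _) => [|z p] /=; first by rewrite exy e_sym exy.
by rewrite !cat_path !last_cat /= exy (e_sym y) exy.
Qed.

(** The walk is cut at the first visit of [x]: [s] collects the visits before it and [t] those after
    it. *)
Lemma edge_visits_detour x y R : x \in R ->
  exists s t, edge_visits R = s ++ t
           /\ edge_visits (detour x y R) = s ++ [:: (x, y), (y, x) & t].
Proof.
move=> Rx; set p := take (index x R) R; set q := drop (index x R).+1 R.
exists (edge_visits (rcons p x)), (edge_visits (x :: q)); split.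
  by rewrite -edge_visits_cat -split_index.
by rewrite /detour edge_visits_cat.
Qed.

Lemma traversals_detour x y R f : x \in R ->
  traversals f (detour x y R) = 2 * ([set x; y] == f) + traversals f R.
Proof.
move=> Rx; have [s [t [eR eD]]] := @edge_visits_detour x y R Rx.
rewrite /traversals eR eD !count_cat /= (setUC [set y]).
by rewrite 2!(addnCA (count _ s)) addnA addnn mul2n.
Qed.

Definition visits_edge f : pred (V * V) := fun d => [set d.1; d.2] == f.

(** Neither [s] nor [t] visits [f], so filtering isolates the detour. The first part tells which
    endpoint it starts from, the second recovers the old walk. *)
Lemma detour_filter x y R (f := [set x; y]) :
    x \in R -> traversals f R = 0 ->
  [seq d <- edge_visits (detour x y R) | visits_edge f d] = [:: (x, y); (y, x)]
  /\ [seq d <- edge_visits (detour x y R) | ~~ visits_edge f d] = edge_visits R.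
Proof.
move=> Rx /eqP; rewrite eqn0Ngt -has_count -all_predC.
have [s [t [-> ->]]] := @edge_visits_detour x y R Rx.
rewrite all_cat => /andP[sN tN].
have pN u : all (predC (visits_edge f)) u ->
    filter (visits_edge f) u = [::] /\ filter (predC (visits_edge f)) u = u.
  move=> uN; split; last exact/all_filterP.
  by apply/eqP; rewrite -size_eq0 size_filter eqn0Ngt -has_count -all_predC.
have [s1 s2] := pN s sN; have [t1 t2] := pN t tN.
by rewrite !filter_cat /= /visits_edge /= (setUC [set y]) eqxx /= s1 t1 s2 t2.
Qed.

(** The size of [L] is [2] to the power [#|F| + 1 - #|U|], the cycle rank of the graph [(U, F)]; the
    product form avoids truncated subtraction. *)
Definition walk_family (F : {set {set V}}) (U : {set V}) (L : seq (seq V)) :=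
  [/\ F \subset edges e, 2 ^ #|F|.+1 = 2 ^ #|U| * size L,
      uniq (map (@edge_visits V) L)
    & forall R, R \in L -> [/\ closed_walk e R, R =i U
                             & forall f, traversals f R = 2 * (f \in F)]].

(** Erasing the visits of the new edge is a left inverse of the detour on visit sequences. *)
Lemma uniq_detours x y (L : seq (seq V)) :
    {in L, forall R, x \in R /\ traversals [set x; y] R = 0} ->
  uniq (map (@edge_visits V) L) ->
  uniq (map (@edge_visits V) (map (detour x y) L)).
Proof.
move=> LP uL; apply: (@map_uniq _ _ (filter (predC (visits_edge [set x; y])))).
rewrite -!map_comp (_ : map _ L = map (@edge_visits V) L) //.
by apply/eq_in_map => R /LP[Rx /(detour_filter Rx)[]].
Qed.

Lemma detour_walks (F : {set {set V}}) (U : {set V}) x y (f := [set x; y]) R :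
    x \in U -> e x y -> f \notin F ->
    [/\ closed_walk e R, R =i U & forall g, traversals g R = 2 * (g \in F)] ->
  [/\ closed_walk e (detour x y R), detour x y R =i y |: U
    & forall g, traversals g (detour x y R) = 2 * (g \in f |: F)].
Proof.
move=> Ux exy fF [cR RU tR]; have Rx : x \in R by rewrite RU.
split=> [|z|g]; first exact: detour_closed.
  by rewrite mem_detour // !inE RU.
rewrite traversals_detour // tR in_setU1 eq_sym -mulnDr.
by case: eqP => [->|_] //; rewrite (negPf fF).
Qed.

Lemma walk_family_extend F U L x y :
    walk_family F U L -> x \in U -> e x y -> irreflexive e ->
    [set x; y] \notin F ->
  exists L', walk_family ([set x; y] |: F) (y |: U) L'.
Proof.
move=> [FE szL uL LP] Ux exy e_irr; set f := [set x; y] => fF.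
have fE : f \in edges e by apply/imset2P; exists x y; rewrite ?inE.
have FE' : f |: F \subset edges e by rewrite subUset sub1set fE.
have LP' z : z \in U -> {in L, forall R, z \in R /\ traversals f R = 0}.
  by move=> Uz R /LP[_ -> ->]; rewrite (negPf fF).
have uLx := @uniq_detours x y L (LP' x Ux) uL.
have LPx R := @detour_walks F U x y R Ux exy fF.
(* If [y] is new, [F] and [U] both gain one element, so the size of the family must not change. *)
have [Uy|Uy] := boolP (y \in U); last first.
  exists (map (detour x y) L); split=> //.
    by rewrite !cardsU1 fF Uy size_map !expnS -mulnA -szL expnS.
  by move=> _ /mapP[R /LP/LPx RP ->].
have yU : y |: U = U by apply/setUidPr; rewrite sub1set.
have fC : [set y; x] = f by rewrite setUC.
have eyx : e y x by rewrite e_sym.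
have xU : x |: U = U by apply/setUidPr; rewrite sub1set.
exists (map (detour x y) L ++ map (detour y x) L); split=> //.
- by rewrite yU cardsU1 fF size_cat !size_map addnn -mul2n mulnCA -szL -expnS.
- rewrite map_cat cat_uniq uLx uniq_detours ?fC ?andbT; last exact: uL.
    (* A common visit sequence would traverse the new edge first as [(x, y)] and first as [(y, x)],
       forcing [x = y]. *)
    apply/hasPn => _ /mapP[_ /mapP[R LR ->] ->]; apply/negP.
    case/mapP=> _ /mapP[R' LR' ->] eqD.
    have [Rx tR'] := LP' x Ux R' LR'; have [Ry tR] := LP' y Uy R LR.
    have [Dx _] := detour_filter Rx tR'.
    rewrite -fC in tR; have [Dy _] := detour_filter Ry tR.
    rewrite eqD fC Dx in Dy; case: Dy => xy _.
    by rewrite xy e_irr in exy.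
  exact: LP'.
- move=> R'; rewrite mem_cat => /orP[] /mapP[R /LP RP ->]; first exact: LPx.
  rewrite yU -xU -fC; apply: detour_walks => //; by rewrite fC.
Qed.

Lemma walk_family_nonempty F U L :
  walk_family F U L -> exists2 R, R \in L & exists x, x \in U.
Proof.
case=> _ szL _ LP; have: 0 < size L.
  by have := expn_gt0 2 #|F|.+1; rewrite szL muln_gt0 => /andP[].
case: L {szL} LP => // R L LP _; exists R; rewrite ?mem_head //.
have [cR RU _] := LP R (mem_head _ _).
by case: R cR RU {LP} => // x p _ RU; exists x; rewrite -RU mem_head.
Qed.

(** This is where growth stops. Every edge leaving a node of [U] is in [F], hence traversed by a
    walk on [U], so [U] is closed under adjacency and connectedness makes it everything. *)
Lemma walk_family_frontier F U L :
    walk_family F U L -> (forall x y, connect e x y) ->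
    (forall x y, x \in U -> e x y -> [set x; y] \in F) ->
  U = setT /\ F = edges e.
Proof.
move=> famL conn step; have [R LR [x0 Ux0]] := walk_family_nonempty famL.
have [FE _ _ /(_ R LR)[_ RU tR]] := famL.
have Ucl x y : e x y -> x \in U -> y \in U.
  move=> exy Ux; have Fxy := step x y Ux exy.
  have: 0 < traversals [set x; y] R by rewrite tR Fxy.
  rewrite -has_count => /hasP[d /mem_edge_visits/andP[d1 d2] /eqP dxy].
  have: y \in [set d.1; d.2] by rewrite dxy !inE eqxx orbT.
  by rewrite -RU !inE => /orP[]/eqP->.
have UT : U = setT.
  apply/setP=> y; rewrite inE; have /connectP[p ep ->] := conn x0 y.
  elim: p x0 Ux0 ep => //= z p IHp x Ux /andP[exz]; apply: IHp.
  exact: Ucl exz Ux.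
split=> //; apply/eqP; rewrite eqEsubset FE; apply/subsetP => f.
by case/imset2P=> x y _ exy ->; apply: step; rewrite // UT inE.
Qed.

Lemma walk_family_edges : irreflexive e -> connected_graph e ->
  exists L, walk_family (edges e) setT L.
Proof.
move=> e_irr [/card_gt0P[x0 _] conn].
(* The walk of length zero visits one node and no edge: [2 ^ 1 = 2 ^ 1 * 1]. *)
have fam0 : walk_family set0 [set x0] [:: [:: x0]].
  split; rewrite ?sub0set ?cards0 ?cards1 // => R /[!inE]/eqP->.
  by split=> [|x|f]; rewrite /= ?eqxx ?inE.
(* Induction on a strict bound for the number of edges still outside [F]. *)
move: (ltnSn #|edges e :\: set0|); move: {-1}_.+1 fam0 => n.
elim: n set0 [set x0] [:: _] => // n IHn F U L famL ltn.
pose P d := [&& d.1 \in U, e d.1 d.2 & [set d.1; d.2] \notin F].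
case: (pickP P) => [[x y] /and3P[/= Ux exy fF]|noP]; last first.
  have [|<- <-] := walk_family_frontier famL conn; last by exists L.
  move=> x y Ux exy; have := noP (x, y).
  by rewrite /P /= Ux exy => /negbFE.
have [L' famL'] := walk_family_extend famL Ux exy e_irr fF.
apply: IHn famL' _; rewrite -ltnS; apply: leq_trans ltn.
rewrite ltnS; apply: proper_card; apply/properP; split.
  by apply: setDS; apply: subsetUr.
exists [set x; y]; rewrite !inE ?eqxx ?fF //=.
by apply/imset2P; exists x y; rewrite ?inE.
Qed.

(** Two traversals of every edge are within the bounds for a route, and the visit sequences are
    pairwise distinct. *)
Lemma size_walk_family U L :
  walk_family (edges e) U L -> size L <= num_routes e.
Proof.
case=> _ _ uL LP; rewrite -(size_map (@edge_visits V)).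
apply: uniq_leq_size => // _ /mapP[R LR ->]; rewrite mem_undup.
have [cR _ tR] := LP R LR.
have /mem_F1[R' FR' ->] : route e R.
  by rewrite /route cR; apply/forall_inP => f fE; rewrite tR fE.
by apply/mapP; exists R'; rewrite ?mem_enum.
Qed.

End Detours.

Theorem lemma2 (V : finType) (e : rel V)
  (e_sym : symmetric e) (e_irrefl : irreflexive e)
  (e_conn : connected_graph e) :
  (2 : rat) ^ (1 - (#|V|)%:Z + (#|edges e|)%:Z) <= (num_routes e)%:R.
Proof.
have [L famL] := walk_family_edges e_sym e_irrefl e_conn.
have := size_walk_family famL; rewrite -(ler_nat rat).
apply: Order.POrderTheory.le_trans.
case: famL => _ /(congr1 (fun n => n%:R : rat)) + _ _.
rewrite natrM !natrX cardsT => szL.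
have nz2 k : (2 : rat) ^+ k != 0 by rewrite expf_neq0.
(* With the exponent regrouped as [(1 + #|edges e|) - #|V|], the power is a quotient that [szL]
   reduces to the size of [L]. *)
rewrite addrAC expfzDr // -PoszD add1n -exprnP szL -exprnN.
by rewrite mulrAC mulfV // mul1r.
Qed.
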